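(* Let $L_n$ be the number of cyclic points in a uniformly random connected parking function of length $n$. Then $n^{-1/2}L_n$ converges in distribution to $|N(0,1)|$ as $n\to\infty$.
   Context: $[n]=\{1,\dots,n\}$. Parking functions: there are $n$ parking spaces $1,\dots,n$ in order on a one-way street and $n$ cars $C_1,\dots,C_n$ arriving in this order; car $C_i$ has preferred space $\pi_i\in[n]$, drives to space $\pi_i$ and parks in the first available space among $\pi_i,\pi_i+1,\dots,n$ (leaving unparked if there is none). The sequence $\pi=(\pi_1,\dots,\pi_n)$ is a parking function of length $n$ if all cars are able to park. The digraph $G_\pi$ has vertex set $[n]$ and edges $i\to\pi_i$. The parking function $\pi$ is called connected if $G_\pi$ has exactly one (weakly connected) component. Cyclic points are the vertices lying on directed cycles of $G_\pi$ (loops count as cycles of length $1$). $|N(0,1)|$ denotes the folded normal distribution, i.e. the law of the absolute value of a standard normal random variable. *)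

(* Defs.v *)
From HB Require Import structures.
From mathcomp Require Import all_boot all_order all_algebra.
From mathcomp Require Import boolp.

Set Implicit Arguments.
Unset Strict Implicit.
Unset Printing Implicit Defensive.

Import Order.TTheory GRing.Theory Num.Theory.

(* Cars and parking spaces 1, ..., n are both indexed by 'I_n = {0, ..., n-1};
   the same shift is applied to i and to pi_i, so the digraph i -> pi_i is only
   relabelled. *)

Local Open Scope nat_scope.

Section Parking.
Variable n : nat.
Implicit Types (pi : {ffun 'I_n -> 'I_n}) (occ : {set 'I_n}).

(* [enum 'I_n] is increasing, so the head of the list is the least space. *)
Definition first_available occ (j : 'I_n) : option 'I_n :=
  ohead [seq k : 'I_n <- enum 'I_n | (j <= k) && (k \notin occ)].

(* [s] lists the preferences of the cars still to arrive, in order of arrival,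
   and [occ] is the set of spaces taken by the earlier cars. *)
Fixpoint all_park occ (s : seq 'I_n) : bool :=
  if s is j :: s' then
    if first_available occ j is Some k then all_park (k |: occ) s' else false
  else true.

Definition parking_function pi : bool :=
  all_park set0 [seq pi i | i <- enum 'I_n].

Definition arc_rel pi : rel 'I_n := [rel i j | pi i == j].

Definition weak_arc_rel pi : rel 'I_n :=
  [rel i j | arc_rel pi i j || arc_rel pi j i].

Definition connected_digraph pi : bool :=
  n_comp (weak_arc_rel pi) 'I_n == 1.

Definition connected_parking_function pi : bool :=
  parking_function pi && connected_digraph pi.

(* [ucycle e c]: [c] is a directed [e]-cycle without repeated vertices, with
   [ucycle e [:: x]] iff [e x x]. *)
Definition cyclic_point pi (x : 'I_n) : Prop :=
  exists2 c : seq 'I_n, ucycle (arc_rel pi) c & x \in c.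

Definition cyclic_count pi : nat := #|[set x | `[< cyclic_point pi x >]]|.

End Parking.

Definition connected_pf n :=
  { pi : {ffun 'I_n -> 'I_n} | connected_parking_function pi }.
HB.instance Definition _ n := Finite.on (connected_pf n).

(* [connected_pf 0] is empty, so the probability space is built for lengths
   n.+1, where the constant function is a connected parking function. *)
Section NonEmpty.
Variable n : nat.

Let cst : {ffun 'I_n.+1 -> 'I_n.+1} := [ffun=> ord0].

Let all_park_cst (m c : nat) : c + m <= n.+1 ->
  all_park [set k : 'I_n.+1 | k < c] (nseq m ord0).
Proof.
elim: m c => [//|m IHm] c cm /=.
have cn : c < n.+1 by rewrite (leq_trans _ cm)// addnS ltnS leq_addr.
have step : Ordinal cn |: [set k : 'I_n.+1 | k < c] = [set k : 'I_n.+1 | k < c.+1].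
  by apply/setP => k; rewrite !inE ltnS [in RHS]leq_eqVlt -val_eqE.
suff -> : first_available [set k : 'I_n.+1 | k < c] ord0 = Some (Ordinal cn).
  by rewrite step IHm// addSnnS.
rewrite /first_available.
set s := filter _ _.
have s_sorted : sorted ltn (map val s).
  apply: (subseq_sorted ltn_trans _ (iota_ltn_sorted 0 n.+1)).
  by rewrite -val_enum_ord; apply: map_subseq; exact: filter_subseq.
have sP k : (k \in s) = (c <= k).
  by rewrite mem_filter mem_enum inE inE -leqNgt andbT.
have := sP (Ordinal cn); rewrite /= leqnn.
case: s s_sorted sP => [//|k s] /= ks sP.
rewrite inE => /orP[/eqP <-//|kins].
have /= ck : c <= k by rewrite -sP mem_head.
move: ks; rewrite path_sortedE => [/andP[/allP/(_ c) ks _]|]; last exact: ltn_trans.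
have : ltn k c by apply: ks; apply/mapP; exists (Ordinal cn).
by rewrite /= ltnNge ck.
Qed.

Fact cst_connected_parking_function : connected_parking_function cst.
Proof.
apply/andP; split.
  rewrite /parking_function.
  have -> : [seq cst i | i <- enum 'I_n.+1] = nseq n.+1 ord0.
    apply: (@eq_from_nth _ ord0); first by rewrite size_map size_enum_ord size_nseq.
    move=> i; rewrite size_map => ilt.
    by rewrite (nth_map ord0)// ffunE nth_nseq if_same.
  have -> : set0 = [set k : 'I_n.+1 | k < 0] by apply/setP => k; rewrite !inE.
  exact: all_park_cst.
have csym : connect_sym (weak_arc_rel cst).
  by apply: sym_connect_sym => x y; exact: orbC.
rewrite /connected_digraph -(n_comp_connect csym ord0); apply/eqP/eq_n_comp_r => x.
by rewrite !inE; apply/esym/connect1/orP; right; rewrite /arc_rel /= ffunE.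
Qed.

Definition const_connected_pf : connected_pf n.+1 :=
  exist _ cst cst_connected_parking_function.

End NonEmpty.

(* Imported only now because [set0] and [set x | P] denote finite sets above. *)
From mathcomp Require Import finmap.
From mathcomp Require Import all_classical all_reals all_analysis.
Import numFieldNormedType.Exports.

HB.instance Definition _ n :=
  isPointed.Build (connected_pf n.+1) (const_connected_pf n).

HB.instance Definition _ n := @isMeasurable.Build default_measure_display
  (connected_pf n.+1) discrete_measurable discrete_measurable0
  discrete_measurableC discrete_measurableU.

Local Open Scope classical_set_scope.
Local Open Scope ring_scope.

Section Uniform.
Variables (R : realType) (n : nat).

Definition uniform_connected_pf : set (connected_pf n.+1) -> \bar R :=
  mscale ((#|{: connected_pf n.+1}|%:R : R)^-1)%:nng
    (@counting (connected_pf n.+1) R).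

HB.instance Definition _ := Measure.on uniform_connected_pf.

Let uniform_connected_pf_setT : uniform_connected_pf [set: connected_pf n.+1] = 1%E.
Proof.
rewrite /uniform_connected_pf /mscale /= /counting asboolT; last exact: finite_finset.
rewrite -EFinM; congr (_%:E).
have -> : #|` fset_set [set: connected_pf n.+1]| = #|{: connected_pf n.+1}|.
  have -> : [set: connected_pf n.+1] = [set` [fset x | x in {: connected_pf n.+1}]%fset].
    by apply/seteqP; split => // x _ /=; apply/imfsetP; exists x.
  by rewrite set_fsetK card_imfset //= -cardE.
by rewrite mulVf// pnatr_eq0 -lt0n; apply/card_gt0P; exists (const_connected_pf n).
Qed.

HB.instance Definition _ :=
  @Measure_isProbability.Build _ _ R uniform_connected_pf uniform_connected_pf_setT.

(* N^{-1/2} L_N with N = n.+1; every subset of the domain is measurable. *)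
Definition scaled_cyclic_count (pi : connected_pf n.+1) : R :=
  (cyclic_count (val pi))%:R / Num.sqrt n.+1%:R.

Let measurable_scaled_cyclic_count :
  measurable_fun [set: connected_pf n.+1] scaled_cyclic_count.
Proof. by []. Qed.

HB.instance Definition _ := @isMeasurableFun.Build _ _ _ _
  scaled_cyclic_count measurable_scaled_cyclic_count.

End Uniform.

Arguments uniform_connected_pf R n : clear implicits.
Arguments scaled_cyclic_count R n : clear implicits.

Section AbsoluteValue.
Variable R : realType.

(* [Num.norm], with as domain the alias of R that [normal_prob] lives on. *)
Definition abs_value (x : measurableTypeR R) : R := `|x : R|.

Let measurable_abs_value : measurable_fun [set: measurableTypeR R] abs_value.
Proof. exact: measurable_realfun.normr_measurable. Qed.

HB.instance Definition _ := @isMeasurableFun.Build _ _ _ _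
  abs_value measurable_abs_value.

End AbsoluteValue.

Arguments abs_value R x : clear implicits.

Definition cvg_in_distribution (R : realType)
    (d : nat -> measure_display) (T : forall n, measurableType (d n))
    (P : forall n, probability (T n) R) (X : forall n, {RV (P n) >-> R})
    (d' : measure_display) (T' : measurableType d')
    (P' : probability T' R) (Y : {RV P' >-> R}) : Prop :=
  forall r : R, {for r, continuous (cdf Y)} ->
    cdf (X n) r @[n --> \oo] --> cdf Y r.

(* Main.v *)
(* Parkability depends only on the multiset of preferences. A connected map f
   with a chosen cyclic point x is encoded as the word listing the cycle from x,
   followed by the reversed Pruefer code of the forest hanging off the cycle;
   this word is a rearrangement of the values of f, and its first repeated
   letter comes right after the cycle. Hence, with C_k the number of connected
   parking functions with k cyclic points and B_k the number of parking
   functions whose first k values are distinct, k C_k = B_k - B_(k+1) for k < n.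
   Pollak's rotation argument gives (n+1) B_k = (n+1)_k (n+1)^(n-k), so that C_k
   is proportional to b_k = (1 - 1/N) ... (1 - (k-1)/N) with N = n+1, up to a
   factor N/n at k = n.
   Since exp(-k^2/(2(N-m))) <= b_k <= exp(-(k-1)^2/(2N)) for k <= m, comparing
   with the increments of the distribution function of |N(0,1)| shows that the
   sums of b_k over k <= r sqrt(n) are asymptotically a fixed multiple of
   sqrt(n) P(|N(0,1)| <= r). *)

Require Import Defs.
From mathcomp Require Import all_boot all_order all_algebra.
From mathcomp Require Import boolp.
From mathcomp Require Import zify.

Set Implicit Arguments.
Unset Strict Implicit.
Unset Printing Implicit Defensive.

(** * Pruefer codes and connected maps *)

Section Prufer.
Variable I : finType.
Implicit Types (W A : {set I}) (f g : I -> I) (w : seq I).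

(** [f] has no cycle inside [W]: a nonempty subset that [f] never leaves would contain one. In this
    form the property passes to subsets at once. *)
Definition acyclic_on W f :=
  forall A, A \subset W -> A != set0 -> exists2 i, i \in A & f i \notin A.

(* The fuel [k] is meant to be #|W|. [pick] depends only on the set it is applied
   to, which [unprufer] recovers from the letters still to be read. *)
Fixpoint prufer k W f : seq I :=
  if k is k'.+1 then
    if [pick v in W :\: [set f i | i in W]] is Some v then f v :: prufer k' (W :\ v) f
    else [::]
  else [::].

Fixpoint unprufer W w (g : {ffun I -> I}) : {ffun I -> I} :=
  if w is c :: w' then
    if [pick v in W :\: [set:: w]] is Some v then
      [ffun i => if i == v then c else unprufer (W :\ v) w' g i]
    else g
  else g.

Lemma acyclic_onS A W f : A \subset W -> acyclic_on W f -> acyclic_on A f.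
Proof. by move=> AW h B BA; apply: h; apply: subset_trans AW. Qed.

(** Without a leaf, [W] would lie in its image, hence equal it by cardinality, and [W] itself would
    be closed under [f]. *)
Lemma acyclic_on_leaf W f : acyclic_on W f -> W != set0 ->
  W :\: [set f i | i in W] != set0.
Proof.
move=> acW W0; apply/negP => /eqP/setP sub.
have {}sub : W \subset [set f i | i in W].
  by apply/subsetP => i iW; move: (sub i); rewrite !inE iW andbT => /negbFE.
have eqW : W = [set f i | i in W].
  by apply/eqP; rewrite eqEcard sub leq_imset_card.
have [i iW] := acW W (subxx _) W0.
by rewrite [in X in _ \notin X]eqW imset_f.
Qed.

Lemma prufer_perm k W f : acyclic_on W f -> k = #|W| ->
  perm_eq (prufer k W f) [seq f i | i <- enum W].
Proof.
elim: k W => [|k IH] W acW kW /=.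
  by rewrite (cards0_eq (esym kW)) enum_set0.
have W0 : W != set0 by rewrite -card_gt0 -kW.
case: pickP => [v|/= all0]; last first.
  by case/set0Pn: (acyclic_on_leaf acW W0) => v; rewrite all0.
rewrite inE => /andP[_ vW].
have kW' : k = #|W :\ v| by move: kW; rewrite (cardsD1 v) vW => -[].
have := IH _ (acyclic_onS (subD1set W v) acW) kW'.
rewrite -(perm_cons (f v)) => /perm_trans; apply.
rewrite -[_ :: _]/(map f (v :: enum (W :\ v))); apply: perm_map.
apply: uniq_perm => [||i]; rewrite /= ?enum_uniq ?mem_enum ?inE ?eqxx //.
by rewrite !mem_enum !inE; case: eqP => [->|].
Qed.

(** This is how the decoder finds the leaves: the letters still to be read are exactly the values of
    [f] on the remaining vertices. *)
Lemma prufer_set k W f : acyclic_on W f -> k = #|W| ->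
  [set:: prufer k W f] = [set f i | i in W].
Proof.
move=> acW kW; apply/setP => j; rewrite inE (perm_mem (prufer_perm acW kW)).
apply/mapP/imsetP => -[i iW ->]; exists i => //; move: iW; by rewrite mem_enum.
Qed.

Lemma size_prufer W f : acyclic_on W f -> size (prufer #|W| W f) = #|W|.
Proof. by move=> /prufer_perm/(_ erefl)/perm_size; rewrite size_map cardE. Qed.

Lemma pruferK k W f (g : {ffun I -> I}) : acyclic_on W f -> k = #|W| ->
  {in W, unprufer W (prufer k W f) g =1 f}.
Proof.
elim: k W => [|k IH] W acW kW i iW.
  by move: iW; rewrite (cards0_eq (esym kW)) inE.
have := prufer_set acW kW; rewrite /=.
have W0 : W != set0 by rewrite -card_gt0 -kW.
case pv: [pick v in _] => [v|]; last first.
  case/set0Pn: (acyclic_on_leaf acW W0) => v vW.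
  by case: pickP pv => // /(_ v); rewrite vW.
have vW : v \in W by case: pickP pv => // u uP [<-]; case/setDP: uP.
move=> setE /=; rewrite setE pv ffunE; case: eqP => [->//|/eqP iv].
apply: IH; [exact: acyclic_onS (subD1set W v) acW| |by rewrite !inE iv].
by move: kW; rewrite (cardsD1 v) vW => -[].
Qed.

(** A single remaining vertex cannot be a fixed point. Otherwise the last letter avoids [W :\ v] by
    induction, and it is not [v] because the leaf [v] is not a value of [f] on [W]. *)
Lemma last_prufer k W f x : acyclic_on W f -> k = #|W| -> W != set0 ->
  last x (prufer k W f) \notin W.
Proof.
elim: k W x => [|k IH] W x acW kW W0.
  by rewrite -card_gt0 -kW in W0.
have := prufer_set acW kW; rewrite /=.
case: pickP => [v /setDP[vW vf]|all0 _]; last first.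
  by case/set0Pn: (acyclic_on_leaf acW W0) => v vW; move: (all0 v); rewrite vW.
have kW' : k = #|W :\ v| by move: kW; rewrite (cardsD1 v) vW => -[].
move=> setE; have acW' := acyclic_onS (subD1set W v) acW.
have [W'0|W'0] := eqVneq (W :\ v) set0.
  have -> : k = 0 by rewrite kW' W'0 cards0.
  have [i] : exists2 i, i \in [set v] & f i \notin [set v].
    by apply: acW; rewrite ?sub1set // -card_gt0 cards1.
  rewrite inE => /eqP -> /= fv; have := in_set0 (f v).
  by rewrite -W'0 in_setD fv /= => ->.
have := IH _ (f v) acW' kW' W'0; rewrite in_setD negb_and negbK.
case/orP => //; rewrite inE => /eqP lv.
by have := mem_last (f v) (prufer k (W :\ v) f); rewrite lv;
  move: vf; rewrite -setE inE => /negbTE ->.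
Qed.

Lemma unprufer_out W w (g : {ffun I -> I}) i : i \notin W -> unprufer W w g i = g i.
Proof.
elim: w W => [|c w IH] W iW //=.
case: pickP => [v /setDP[vW _]|//].
by rewrite ffunE; case: eqP => [iv|_]; [rewrite iv vW in iW|rewrite IH // !inE negb_and iW orbT].
Qed.

(** Surjectivity of the code. Besides the length, the only constraint is that the last letter lies
    outside [W]; it guarantees a leaf at each step. *)
Lemma unpruferP W w (g : {ffun I -> I}) x : size w = #|W| -> (w != [::] -> last x w \notin W) ->
  let h := unprufer W w g in acyclic_on W h /\ prufer #|W| W h = w.
Proof.
elim: w W x => [|c w IH] W x /= sw lw.
  rewrite -sw /=; split=> // A; rewrite (cards0_eq (esym sw)) subset0 => /eqP ->.
  by rewrite eqxx.
have lst : last c w \notin W by exact: lw.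
case pv: [pick v in _] => [v|]; last first.
  (* Pigeonhole: the [#|W|] letters include one outside [W], so they cannot cover [W]. *)
  have : W \subset [set:: c :: w] :\ last c w.
    apply/subsetP => i iW; case: pickP pv => // /(_ i) + _.
    rewrite !inE iW andbT => /negbFE ->; rewrite andbT.
    by apply: contraNneq lst => <-.
  move/subset_leq_card => card_le; exfalso; move: card_le; rewrite -sw leqNgt => /negP[].
  have := cardsD1 (last c w) [set:: c :: w]; rewrite inE mem_last add1n => <-.
  by rewrite cardsE; apply: card_size.
have [vW vw] : v \in W /\ v \notin [set:: c :: w].
  by case: pickP pv => // u uP [<-]; case/setDP: uP.
move: vw; rewrite !inE negb_or => /andP[vc vw].
have sw' : size w = #|W :\ v| by move: sw; rewrite (cardsD1 v) vW => -[].
have lw' : w != [::] -> last c w \notin W :\ v by rewrite in_setD (negbTE lst) andbF.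
have [acW' prE] := IH _ c sw' lw'; set h' := unprufer _ _ _ in acW' prE *.
set h := [ffun i => _].
have hh' i : i \in W :\ v -> h i = h' i by case/setD1P => /negbTE iv _; rewrite ffunE iv.
have setE : [set h i | i in W] = [set:: c :: w].
  rewrite -(setD1K vW) imsetU1 set_cons; congr setU.
    by rewrite ffunE eqxx.
  by rewrite (eq_in_imset hh') -(prufer_set acW' erefl) prE.
have acW : acyclic_on W h.
  (* If [A] is just [v], the value [c] differs from [v]. Otherwise some vertex of [A :\ v] escapes
     [A :\ v] by induction, and it does not land on [v], which is not a letter. *)
  move=> A AW A0; have [Av|Av] := eqVneq (A :\ v) set0.
    have Asub : A \subset [set v] by rewrite -setD_eq0 Av.
    have AE : A = [set v] by apply/eqP; rewrite eqEcard Asub cards1 card_gt0.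
    by exists v; rewrite AE inE // ffunE eqxx eq_sym.
  have [i iA hi] := acW' _ (setSD _ AW) Av.
  exists i; first by case/setD1P: iA.
  have iW : i \in W :\ v by apply: (subsetP (setSD [set v] AW)).
  rewrite hh' //; move: hi; rewrite in_setD1 negb_and negbK => /orP[|//].
  move=> /eqP h'v; have : v \in [set h' i | i in W :\ v] by apply/imsetP; exists i.
  by rewrite -(prufer_set acW' erefl) prE inE (negbTE vw).
split=> //; have -> : #|W| = #|W :\ v|.+1 by rewrite (cardsD1 v) vW.
rewrite /= setE pv; congr cons; first by rewrite ffunE eqxx.
(* [h] and [h'] agree on [W :\ v], hence have the same code on each of its acyclic subsets. *)
rewrite -prE; move: #|_| acW' => k; clear -hh'.
elim: k {-2}(W :\ v) (subxx (W :\ v)) => [//|k IH] A AW acW' /=.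
rewrite (eq_in_imset (fun i iA => hh' i (subsetP AW i iA))).
case: pickP => [u /setDP[uA _]|//]; rewrite hh' ?(subsetP AW) //; congr cons.
apply: IH; last exact: acyclic_onS (subD1set _ _) acW'.
exact: subset_trans (subD1set _ _) AW.
Qed.

(** The code is reversed so that its last letter, which lies on the cycle, comes immediately after
    the cycle and marks where it ends. *)
Definition cycle_encode f x : seq I :=
  orbit f x ++ rev (prufer #|~: [set:: orbit f x]| (~: [set:: orbit f x]) f).

Definition cycle_decode (x0 : I) k w : {ffun I -> I} * I :=
  (unprufer (~: [set:: take k w]) (rev (drop k w)) [ffun i => next (take k w) i],
   head x0 (take k w)).

(** [k] is the length of the longest prefix with distinct letters; a word without repetition has
    [k = size w]. *)
Definition first_repeat k w :=
  uniq (take k w) && ((k < size w) ==> ~~ uniq (take k.+1 w)).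

(** A set closed under [f] contains the forward orbits of its points, and each of these passes
    through [x]. *)
Lemma absorbing_acyclic f x W : (forall y, fconnect f y x) -> x \notin W ->
  acyclic_on W f.
Proof.
move=> reach xW A AW /set0Pn[y yA].
case: (boolP [exists i in A, f i \notin A]) => [/exists_inP[i iA fi]|]; first by exists i.
rewrite negb_exists_in => /forall_inP fA.
suff : x \in A by move/(subsetP AW); rewrite (negbTE xW).
rewrite -(iter_findex (reach y)); elim: (findex f y x) => //= m /fA.
by rewrite negbK.
Qed.

Lemma absorbing_orbit_acyclic f x : (forall y, fconnect f y x) ->
  acyclic_on (~: [set:: orbit f x]) f.
Proof. by move=> /absorbing_acyclic; apply; rewrite !inE negbK in_orbit. Qed.

Lemma card_orbitC f x : order f x + #|~: [set:: orbit f x]| = #|I|.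
Proof.
rewrite -[in RHS](cardsC [set:: orbit f x]); congr addn.
by rewrite cardsE (card_uniqP (orbit_uniq f x)) size_orbit.
Qed.

Lemma size_encode f x : (forall y, fconnect f y x) -> size (cycle_encode f x) = #|I|.
Proof.
move=> reach; rewrite size_cat size_rev size_prufer ?size_orbit ?card_orbitC //.
exact: absorbing_orbit_acyclic.
Qed.

(** [f] permutes the cycle, and the Pruefer code lists the values at all other vertices. *)
Lemma encode_perm f x : (forall y, fconnect f y x) ->
  perm_eq (cycle_encode f x) [seq f i | i <- enum I].
Proof.
move=> reach; have acW := absorbing_orbit_acyclic reach.
have orb : perm_eq (orbit f x) [seq f i | i <- orbit f x].
  have xx : iter (order f x) f x = x by apply/(orbitPcycle 2 4)/reach.
  rewrite perm_sym /orbit; have -> : [seq f i | i <- traject f x (order f x)] =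
    traject f (f x) (order f x).
    by move: (order f x) => m; clear; elim: m x => //= m IH z; rewrite IH.
  rewrite -(perm_cons x) -trajectS trajectSr xx.
  by rewrite perm_rcons.
rewrite /cycle_encode (perm_trans (perm_cat orb (permEl (perm_rev _)))) //.
rewrite (perm_trans (perm_cat (perm_refl _) (prufer_perm acW erefl))) //.
rewrite -map_cat; apply: perm_map; apply: uniq_perm; rewrite ?enum_uniq //.
  rewrite cat_uniq orbit_uniq enum_uniq andbT; apply/hasPn => i.
  by rewrite mem_enum !inE.
by move=> i; rewrite mem_cat !mem_enum !inE orbN.
Qed.

Lemma first_repeatP x0 k w : k < size w ->
  first_repeat k w = uniq (take k w) && (nth x0 w k \in take k w).
Proof.
move=> kw; rewrite /first_repeat kw (take_nth x0 kw) rcons_uniq.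
by case: (uniq _) => //=; rewrite andbT negbK.
Qed.

Lemma take_encode f x : take (order f x) (cycle_encode f x) = orbit f x.
Proof. by rewrite take_size_cat // size_orbit. Qed.

Lemma drop_encode f x : rev (drop (order f x) (cycle_encode f x)) =
  prufer #|~: [set:: orbit f x]| (~: [set:: orbit f x]) f.
Proof. by rewrite drop_size_cat ?size_orbit // revK. Qed.

Lemma encode_first_repeat f x : (forall y, fconnect f y x) ->
  first_repeat (order f x) (cycle_encode f x).
Proof.
move=> reach; have acW := absorbing_orbit_acyclic reach.
have [kw|kw] := ltnP (order f x) (size (cycle_encode f x)); last first.
  by rewrite /first_repeat take_encode orbit_uniq ltnNge kw.
rewrite (first_repeatP x) // take_encode orbit_uniq /=.
have W0 : ~: [set:: orbit f x] != set0.
  move: kw; rewrite size_encode // -card_gt0 -(card_orbitC f x).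
  by rewrite -{1}[order f x]addn0 ltn_add2l.
have := last_prufer x acW erefl W0; rewrite !inE negbK -drop_encode.
by rewrite (drop_nth x) // rev_cons last_rcons.
Qed.

Lemma encodeK x0 (f : {ffun I -> I}) x : (forall y, fconnect f y x) ->
  cycle_decode x0 (order f x) (cycle_encode f x) = (f, x).
Proof.
move=> reach; have acW := absorbing_orbit_acyclic reach.
rewrite /cycle_decode take_encode drop_encode; congr pair; last first.
  by rewrite /orbit -orderSpred.
apply/ffunP => i; have [iW|iW] := boolP (i \in ~: [set:: orbit f x]).
  by rewrite (pruferK _ acW).
rewrite unprufer_out // ffunE; apply: nextE; last by move: iW; rewrite !inE negbK.
by rewrite -fconnect_f reach.
Qed.

(** The repeated letter at position [k] lies in the prefix, so the reversed remainder ends outside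
    [W] and is a Pruefer code on [W]. *)
Lemma decodeP x0 k w : size w = #|I| -> 0 < k <= #|I| -> first_repeat k w ->
  let: (f, x) := cycle_decode x0 k w in
  [/\ forall y, fconnect f y x, order f x = k & cycle_encode f x = w].
Proof.
move=> sw /andP[k0 kI] /[dup] rep /andP[us _]; rewrite /cycle_decode.
set s := take k w in us *; set W := ~: _; set u := rev _; set g := finfun _.
have ss : size s = k by rewrite size_takel // sw.
have cardW : k + #|W| = #|I|.
  rewrite -[in RHS](cardsC [set:: s]); congr addn.
  by rewrite cardsE (card_uniqP us).
have su : size u = #|W| by rewrite size_rev size_drop sw -cardW addKn.
have lu : u != [::] -> last x0 u \notin W.
  move=> u0; have kw : k < size w.
    by rewrite -subn_gt0 -size_drop -size_rev lt0n size_eq0.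
  rewrite /u (drop_nth x0) // rev_cons last_rcons !inE negbK.
  by move: rep; rewrite (first_repeatP x0) // => /andP[].
have [acW prE] := unpruferP g su lu.
set f := unprufer _ _ _ in acW prE *.
have fs i : i \in s -> f i = next s i.
  by move=> si; rewrite /f unprufer_out ?ffunE // !inE negbK.
have cs : fcycle f s by apply: cycle_from_next => // i si; rewrite /= fs.
have xs : head x0 s \in s by case: (s) ss k0 => [<-|? ? _ _] //; rewrite mem_head.
have orbE : orbit f (head x0 s) = s.
  rewrite (orbitE cs us xs); case: (s) ss k0 => [<-|a r _ _] //=.
  by rewrite eqxx rot0.
have reach y : fconnect f y (head x0 s).
  (* The points not reaching the cycle form a subset of [W]; acyclicity would send one of them to a
     point that does reach it. *)
  apply/negPn/negP => nreach.
  have [||i] := acW [set z | ~~ fconnect f z (head x0 s)].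
  - apply/subsetP => z; rewrite !inE; apply: contra => zs.
    by rewrite (fconnect_cycle cs zs).
  - by apply/set0Pn; exists y; rewrite inE.
  rewrite !inE negbK => + fi; rewrite (connect_trans (fconnect1 f i) fi) //.
split=> //; first by rewrite -size_orbit orbE.
by rewrite /cycle_encode orbE -/W prE revK cat_take_drop.
Qed.

End Prufer.

(** * Parking functions *)

Section ParkingCount.
Variable n : nat.
Implicit Types (occ : {set 'I_n}) (s : seq 'I_n) (pi : {ffun 'I_n -> 'I_n}).

Lemma first_availableP occ (j : 'I_n) :
  if first_available occ j is Some p then
    [/\ j <= p, p \notin occ & forall i : 'I_n, j <= i < p -> i \in occ]
  else forall i : 'I_n, j <= i -> i \in occ.
Proof.
rewrite /first_available; set s := filter _ _.
have sP k : (k \in s) = (j <= k) && (k \notin occ) by rewrite mem_filter mem_enum andbT.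
have s_sorted : sorted ltn (map val s).
  apply: (subseq_sorted ltn_trans _ (iota_ltn_sorted 0 n)).
  by rewrite -val_enum_ord; apply: map_subseq; exact: filter_subseq.
case: s sP s_sorted => [|p s] sP /= ks.
  by move=> i ji; move: (sP i); rewrite ji in_nil /= => /esym/negbFE.
have /andP[jp pocc] : (j <= p) && (p \notin occ) by rewrite -sP mem_head.
split=> // i /andP[ji ip]; apply: contraTT ip => iocc; rewrite -leqNgt.
have : i \in p :: s by rewrite sP ji.
rewrite inE => /predU1P[->//|si].
move: ks; rewrite path_sortedE; last exact: ltn_trans.
by case/andP => /allP/(_ _ (map_f val si)) /ltnW.
Qed.

Lemma card_ge k : k <= n -> #|[set i : 'I_n | k <= i]| = n - k.
Proof.
move=> kn; have := cardsC [set i : 'I_n | k <= i]; rewrite card_ord.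
have -> : ~: [set i : 'I_n | k <= i] = [set widen_ord kn i | i in 'I_k].
  apply/setP => i; rewrite !inE -ltnNge; apply/idP/imsetP => [ik|[j _ ->]]; last exact: (ltn_ord j).
  by exists (Ordinal ik) => //; apply: val_inj.
rewrite card_imset; last by move=> i j /(congr1 val) ij; apply: val_inj.
rewrite card_ord.
by move/(canRL (addnK _)).
Qed.

(** The classical counting criterion, with spaces already taken counted as demand: the [n - k]
    spaces from [k] on must suffice. Only the multiset of preferences enters. *)
Definition parkable occ s :=
  [forall k : 'I_n, #|[set i in occ | k <= i]| + count (fun j : 'I_n => k <= j) s <= n - k].

Lemma all_parkE occ s : all_park occ s = parkable occ s.
Proof.
elim: s occ => [|j s IH] occ /=.
  apply/esym/forallP => k; rewrite addn0 -(card_ge (ltnW (ltn_ord k))); apply: subset_leq_card.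
  by apply/subsetP => i; rewrite !inE => /andP[].
have := first_availableP occ j; case: first_available => [p [jp pocc avail]|full].
  have cardU (k : 'I_n) : #|[set i in p |: occ | k <= i]| =
      (k <= p) + #|[set i in occ | k <= i]|.
    have [kp|kp] := leqP k p.
      rewrite -[RHS]/(1 + _) -[1]/(true : nat)
        -(_ : (p \notin [set i in occ | k <= i]) = true); last first.
        by rewrite !inE negb_and pocc.
      rewrite -cardsU1; apply: eq_card => i; rewrite !inE.
      by case: eqP => [->|//]; rewrite kp.
    apply: eq_card => i; rewrite !inE; case: eqP => [->|//].
    by rewrite leqNgt kp (negbTE pocc).
  rewrite IH; apply/forallP/forallP => H k; move: (H k) => /=; rewrite cardU.
    case: (leqP k j) => [kj|jk]; first by rewrite (leq_trans kj jp) addnCA addnA.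
    by rewrite -addnA; apply/leq_trans/leq_addl.
  have [kj|jk] := leqP k j; first by rewrite (leq_trans kj jp) addnCA addnA.
  (* For [j < k <= p] the spaces from [j] to [k - 1] are all taken, so the bound at [j] before
     parking gives the bound at [k] after it. *)
  have [kp _|//] := leqP k p.
  have := H j; rewrite /= leqnn.
  have -> : #|[set i in occ | j <= i]| = (k - j) + #|[set i in occ | k <= i]|.
    rewrite -(cardsID [set i : 'I_n | k <= i] [set i in occ | j <= i]) addnC; congr addn.
      transitivity #|[set i : 'I_n | j <= i] :\: [set i : 'I_n | k <= i]|.
        apply: eq_card => i; rewrite !inE; case: (leqP k i) => //= ik.
        by case: (leqP j i) => ji; rewrite ?andbF // andbT;
          apply/avail; rewrite ji (leq_trans ik kp).
      rewrite cardsD (setIidPr _) ?card_ge ?(ltnW (ltn_ord _)) //; first by have := ltn_ord k; lia.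
      by apply/subsetP => i; rewrite !inE => /(leq_trans (ltnW jk)).
    apply: eq_card => i; rewrite !inE -andbA; case: (leqP k i) => [ki|]; rewrite ?andbF //.
    by rewrite (leq_trans (ltnW jk) ki) !andbT.
  have : count (fun i : 'I_n => k <= i) s <= count (fun i : 'I_n => j <= i) s.
    by apply: sub_count => i /=; apply: leq_trans (ltnW jk).
  move: #|_| (count _ s) (count _ s) jk (ltn_ord k) => a b c.
  by move: (nat_of_ord k) (nat_of_ord j) => k' j' /=; lia.
(* With every space from [j] on taken, the arriving car already violates the bound at [j]. *)
apply/esym/forallP => /(_ j) /=; rewrite leqnn.
have -> : [set i in occ | j <= i] = [set i : 'I_n | j <= i].
  by apply/setP => i; rewrite !inE andbC; case: (leqP j i) => // /full ->.
by rewrite card_ge ?(ltnW (ltn_ord _)) //= -[X in _ <= X]addn0 leq_add2l.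
Qed.

Lemma all_park_perm s t : perm_eq s t -> all_park set0 s = all_park set0 t.
Proof.
move=> st; rewrite !all_parkE; apply: eq_forallb => k.
by move/permP: st => ->.
Qed.

Lemma cyclic_pointE pi x : cyclic_point pi x <-> fconnect pi (pi x) x.
Proof.
split=> [[c /andP[cc uc] xc]|]; last first.
  rewrite fconnect_f => cx; exists (orbit pi x); last exact: in_orbit.
  by rewrite /ucycle /= orbit_uniq andbT.
rewrite (fconnect_cycle (cc : fcycle pi c)) //.
by rewrite -(nextE cc xc) mem_next.
Qed.

(** The vertices reaching a cyclic point [x] are closed under arcs in both directions: predecessors
    clearly, and successors because a path to [x] either uses the next arc or starts at [x], whose
    cycle returns to it. *)
Lemma absorbingP pi x :
  (forall y, fconnect pi y x) <-> connected_digraph pi /\ cyclic_point pi x.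
Proof.
have csym : connect_sym (weak_arc_rel pi).
  by apply: sym_connect_sym => y z; exact: orbC.
have sub : subrel (fconnect pi) (connect (weak_arc_rel pi)).
  by apply: connect_sub => y z yz; apply/connect1/orP; left.
split=> [reach|[conn /cyclic_pointE cx] y].
  split; last by apply/cyclic_pointE.
  rewrite /connected_digraph -(n_comp_connect csym x); apply/eqP/eq_n_comp_r => y.
  by rewrite !inE csym; apply/esym/sub.
have cxy : connect (weak_arc_rel pi) y x.
  have /card_le1P : n_comp (weak_arc_rel pi) 'I_n <= 1 by rewrite (eqP conn).
  move=> /(_ (fingraph.root (weak_arc_rel pi) x)); rewrite inE /= roots_root // => /(_ isT).
  move/(_ (fingraph.root (weak_arc_rel pi) y)); rewrite !inE /= roots_root //= => /esym/eqP.
  by move/(fingraph.rootP csym).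
have meet z : connect (weak_arc_rel pi) x z -> fconnect pi z x.
  have cl : closed (weak_arc_rel pi) [pred z | fconnect pi z x].
    apply: (intro_closed csym) => a b /= + ax; rewrite !inE in ax *.
    case/orP => /eqP ab; last by apply: connect_trans ax; rewrite -ab; exact: fconnect1.
    move: ax; rewrite fconnect_eqVf => /predU1P[ax|]; last by rewrite ab.
    by rewrite -ab ax.
  by move/(closed_connect cl); rewrite !inE connect0 => /esym.
by apply: meet; rewrite csym.
Qed.

(** Every cyclic point reaches [x], so it shares the cycle of [x], which is the orbit of [x]. *)
Lemma cyclic_count_absorbing pi x : (forall y, fconnect pi y x) ->
  cyclic_count pi = order pi x.
Proof.
move=> reach; apply: eq_card => y; rewrite !inE; apply/asboolP/idP.
  move/cyclic_pointE => cy; have := reach y; rewrite fconnect_orbit.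
  by rewrite fconnect_f in cy => yx; rewrite (fconnect_cycle cy yx) in_orbit.
move=> xy; apply/cyclic_pointE; apply: connect_trans xy; exact: reach.
Qed.

End ParkingCount.

(** * Pollak's rotation argument on a circle of n+1 spaces *)

Section Pollak.
Variable n : nat.
Implicit Types (s : seq 'I_n.+1) (a c : 'I_n.+1).

(** The parking criterion on a circle with one extra space. For a word of [n] letters, [k = n]
    forbids the extra letter [n]. *)
Definition ballot s := [forall k : 'I_n.+1, k <= count (fun a : 'I_n.+1 => a < k) s].

Lemma val_subI a c : (a - c)%R = (if c <= a then a - c else a + n.+1 - c) :> nat.
Proof.
rewrite /= modnDmr; have an := ltn_ord a; have cn := ltn_ord c.
have [ca|ac] := leqP c a; last by rewrite modn_small; lia.
by rewrite (_ : a + _ = a - c + n.+1); [rewrite modnDr modn_small; lia|lia].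
Qed.

(** The left count is over the cyclic window of length [k] from [c]. Adding the letters below [c]
    completes it to an initial segment, plus the whole word when the window wraps around. *)
Lemma count_shift s c k : k <= n ->
  count (fun a => (a - c)%R < k) s + count (fun a : 'I_n.+1 => a < c) s =
  if c + k <= n then count (fun a : 'I_n.+1 => a < c + k) s
  else size s + count (fun a : 'I_n.+1 => a < c + k - n.+1) s.
Proof.
move=> kn; elim: s => [|a s IH] /=; first by case: ifP.
rewrite -/((a - c)%R : nat) addnACA [X in _ + X]IH.
have -> : ((a - c)%R < k) + (a < c) =
  if c + k <= n then (a < c + k : nat) else (a < c + k - n.+1).+1.
  rewrite val_subI; have := ltn_ord a; have := ltn_ord c.
  by case: (leqP (c + k) n); case: (leqP c a); lia.
by case: ifP => _ //; rewrite !addSn addnCA.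
Qed.

(* The good rotations start at the first minimum of the walk
   j |-> #{letters < j} - j; n is added to stay in nat. *)
Lemma ballot_rotation s : size s = n ->
  #|[set c | ballot [seq (a - c)%R | a <- s]]| = 1.
Proof.
move=> sn; pose h (j : nat) := count (fun a : 'I_n.+1 => a < j) s + (n - j).
(* The inequality is strict exactly for [j < c], so the condition says that [c] is the first minimum
   of [h]. *)
have ballotE c : ballot [seq (a - c)%R | a <- s] = [forall j : 'I_n.+1, h c + (j < c) <= h j].
  pose idx k := if c + k <= n then c + k else c + k - n.+1.
  have cn : c <= n := ltn_ord c.
  have step k : k <= n ->
    (k <= count (fun a => (a - c)%R < k) s) = (h c + (idx k < c) <= h (idx k)).
    move=> kn; have := count_shift s c kn; rewrite /h /idx sn.
    have [ck|ck] := leqP (c + k) n; move: (count _ s) (count _ s) (count _ s) => x y z.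
      by rewrite ltnNge leq_addr; lia.
    have -> : c + k - n.+1 < c by lia. lia.
  apply/forallP/forallP => H j; have jn : j <= n := ltn_ord j.
    pose k := if c <= j then j - c else j + n.+1 - c.
    have kn : k <= n by rewrite /k; case: ifP; lia.
    have -> : j = idx k :> nat by rewrite /idx /k; case: (leqP c j); case: ifP; lia.
    rewrite -step //; have := H (inord k); rewrite count_map inordK //.
  by rewrite count_map step //; have := H (inord (idx j)); rewrite inordK // /idx; case: ifP; lia.
(* [g] orders positions lexicographically by [h j], then [j], so its minimum is the first minimum of
   [h]. *)
apply/eqP/cards1P; pose g (j : 'I_n.+1) := h j * n.+1 + j.
have [c _ cmin] := @arg_minnP _ (ord0 : 'I_n.+1) xpredT g isT.
exists c; apply/setP => d; rewrite !inE ballotE.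
have gP (j : 'I_n.+1) : h c + (j < c) <= h j.
  have := cmin j isT; rewrite /g; have := ltn_ord j; have := ltn_ord c.
  by case: ltnP; nia.
apply/forallP/eqP => [H|-> //]; apply: val_inj => /=.
by have := H c; have := gP d; move: (h c) (h d); case: ltngtP => //; lia.
Qed.

Lemma card_take_uniq (T : finType) m k : k <= m ->
  #|[set t : m.-tuple T | uniq (take k t)]| = #|T| ^_ k * #|T| ^ (m - k).
Proof.
move=> km; have mE : k + (m - k) = m by lia.
have usize : #|[set t : k.-tuple T | uniq t]| = #|T| ^_ k.
  by rewrite -(card_uniq_tuples k [pred _ : T | true]); apply: eq_card => t; rewrite !inE all_predT.
rewrite -usize -[in X in _ * X](card_tuple (m - k) T) -cardsT -cardsX.
pose cat_tup (p : k.-tuple T * (m - k).-tuple T) := tcast mE (cat_tuple p.1 p.2).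
have cat_inj : injective cat_tup.
  move=> [a b] [c d] /(congr1 (@tval _ _)); rewrite !val_tcast /= => /eqP.
  by rewrite eqseq_cat ?size_tuple // => /andP[/eqP/val_inj -> /eqP/val_inj ->].
rewrite -(card_imset _ cat_inj); apply: eq_card => t; rewrite !inE.
apply/idP/imsetP => [ut|[[a b] /setXP[au _] ->]].
  have sa : size (take k t) == k by rewrite size_takel // size_tuple.
  have sb : size (drop k t) == m - k by rewrite size_drop size_tuple.
  exists (Tuple sa, Tuple sb); first by apply/setXP; rewrite !inE.
  by apply: val_inj; rewrite /= /cat_tup val_tcast /= cat_take_drop.
by move: au; rewrite inE /cat_tup val_tcast /= take_size_cat ?size_tuple.
Qed.

Definition parking_distinct k :=
  #|[set t : n.-tuple 'I_n | all_park set0 t & uniq (take k t)]|.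

Lemma ballot_widen (t : n.-tuple 'I_n) :
  ballot (map (widen_ord (leqnSn n)) t) = all_park set0 t.
Proof.
rewrite all_parkE; have cnt k : k <= n ->
    (k <= count (fun a : 'I_n => a < k) t) = (count (fun a : 'I_n => k <= a) t <= n - k).
  move=> kn; have := count_predC (fun a : 'I_n => a < k) t; rewrite size_tuple.
  rewrite (eq_count (a1 := predC _) (a2 := fun a : 'I_n => k <= a)); last first.
    by move=> a /=; rewrite -leqNgt.
  by move: (count _ t) (count _ t) => x y; lia.
apply/forallP/forallP => H k.
  have kn : k < n := ltn_ord k.
  have -> : [set i : 'I_n | (i \in set0) && (k <= i)] = set0 by apply/setP => i; rewrite !inE.
  rewrite cards0 -cnt; last exact: ltnW.
  by have := H (widen_ord (leqnSn n) k); rewrite count_map.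
rewrite count_map cnt; last exact: (ltn_ord k).
have [kn|nk] := ltnP k n.
  have := H (Ordinal kn); rewrite /= => /(leq_trans _); apply; exact: leq_addl.
rewrite (_ : count _ t = 0) //; apply/eqP; rewrite -leqn0 leqNgt -has_count.
by apply/hasP => -[a _]; rewrite leqNgt (leq_trans (ltn_ord a) nk).
Qed.

(** Double counting of pairs of a word and a rotation making it a ballot word: rotations preserve
    distinctness of the first [k] letters, and each word has one good rotation. *)
Lemma parking_distinctE k : k <= n ->
  n.+1 * parking_distinct k = n.+1 ^_ k * n.+1 ^ (n - k).
Proof.
move=> kn; pose D := [set t : n.-tuple 'I_n.+1 | uniq (take k t)].
pose shift c (t : n.-tuple 'I_n.+1) := map_tuple (fun a => (a - c)%R) t.
have shift_inj c : injective (shift c).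
  move=> s t /(congr1 (@tval _ _)) /= st; apply: val_inj; apply: inj_map st.
  by move=> a b /= /(@GRing.addIr _ (- c)%R).
have -> : parking_distinct k = #|[set t in D | ballot t]|.
  have wid_inj : injective (map_tuple (widen_ord (leqnSn n)) : n.-tuple 'I_n -> _).
    move=> s t /(congr1 (@tval _ _)) /= st; apply: val_inj; apply: inj_map st.
    by move=> a b /(congr1 val) ab; apply: val_inj.
  rewrite /parking_distinct -(card_imset _ wid_inj); apply: eq_card => t; rewrite !inE.
  apply/imsetP/andP => [[s + ->]|[ut bt]].
    rewrite inE -ballot_widen => /andP[bs us]; split=> //=.
    rewrite -map_take map_inj_uniq //.
    by move=> a b /(congr1 val) ab; apply: val_inj.
  (* The ballot condition at [k = n] excludes the extra letter, so [t] comes from a word over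
     ['I_n]. *)
  have tn : all (fun a : 'I_n.+1 => a < n) t.
    rewrite all_count eqn_leq count_size size_tuple.
    by have /forallP/(_ ord_max) := bt.
  have [s ts] : exists s : n.-tuple 'I_n, t = map_tuple (widen_ord (leqnSn n)) s.
    have tP i : tnth t i < n by move/allP: tn; apply; exact: mem_tnth.
    exists [tuple Ordinal (tP i) | i < n]; apply: eq_from_tnth => i.
    by rewrite tnth_map tnth_mktuple; apply: val_inj.
  exists s => //; rewrite inE -ballot_widen; move: bt ut; rewrite ts => -> /=.
  rewrite -map_take map_inj_uniq //.
  by move=> a b /(congr1 val) ab; apply: val_inj.
rewrite -[X in _ = X ^_ k * X ^ _]card_ord -card_take_uniq // -/D.
transitivity (\sum_(t in D) #|[set c | ballot (shift c t)]|); last first.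
  rewrite -sum1_card; apply: eq_bigr => t _.
  by rewrite -(@ballot_rotation t) ?size_tuple //; apply: eq_card => c; rewrite !inE.
under eq_bigr do rewrite -sum1_card big_mkcond.
rewrite exchange_big /= -[LHS]/(n.+1 * _) -{1}[n.+1]card_ord -sum_nat_const.
apply: eq_bigr => c _.
rewrite -big_mkcondr /= -sum1_card.
rewrite [RHS](_ : _ = \sum_(t | shift c t \in [set t in D | ballot t]) 1); last first.
  apply: eq_bigl => t; rewrite !inE -map_take map_inj_uniq // => a b.
  exact: GRing.addIr.
have shift_bij : bijective (shift c) by apply: injF_bij.
by rewrite (reindex (shift c)) //; apply: onW_bij.
Qed.

End Pollak.

(** * Connected parking functions by number of cyclic points *)

Section ConnectedCount.
Variable n : nat.

Definition connected_count k :=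
  #|[set pi : {ffun 'I_n -> 'I_n} | connected_parking_function pi
      & cyclic_count pi == k]|.

(** Both sides count the pairs of a connected parking function with [k] cyclic points and one of
    these points; [cycle_decode] is the bijection. *)
Lemma connected_count_first_repeat k : 0 < k <= n ->
  k * connected_count k =
  #|[set t : n.-tuple 'I_n | all_park set0 t && first_repeat k t]|.
Proof.
move=> k0n; pose A := [set p : {ffun 'I_n -> 'I_n} * 'I_n |
  [&& parking_function p.1, [forall y, fconnect p.1 y p.2] & order p.1 p.2 == k]].
transitivity #|A|.
  rewrite /connected_count mulnC -sum_nat_const.
  rewrite (eq_bigr (fun pi : {ffun 'I_n -> 'I_n} =>
    \sum_(x | `[< cyclic_point pi x >]) 1)); last first.
    by move=> pi; rewrite inE sum1dep_card => /andP[_ /eqP].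
  rewrite pair_big_dep sum1_card; apply: eq_card => -[pi x]; rewrite !inE /=.
  rewrite unfold_in /= inE; apply/andP/and3P => [[/andP[/andP[pf conn] /eqP ck] /asboolP cx]|].
    have reach : forall y, fconnect pi y x by apply/absorbingP.
    by split=> //; [apply/forallP|rewrite -(cyclic_count_absorbing reach) ck].
  move=> [pf /forallP reach /eqP ok]; have /absorbingP[conn cx] := reach.
  split; last exact/asboolP.
  by rewrite /connected_parking_function pf conn (cyclic_count_absorbing reach) ok eqxx.
case/andP: (k0n) => k0 kn; pose x0 := Ordinal (leq_trans k0 kn).
have kI : 0 < k <= #|'I_n| by rewrite card_ord.
have decP (t : n.-tuple 'I_n) (rep : first_repeat k t) :=
  decodeP x0 (etrans (size_tuple t) (esym (card_ord n))) kI rep.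
have decI : {in [set t : n.-tuple 'I_n | all_park set0 t && first_repeat k t] &,
    injective (fun t : n.-tuple 'I_n => cycle_decode x0 k t)}.
  move=> s t; rewrite !inE => /andP[_ /decP Hs] /andP[_ /decP Ht] E.
  apply: val_inj => /=; move: Hs Ht; rewrite E; case: cycle_decode => f x [_ _ <-] [_ _ <-].
  by [].
rewrite -(card_in_imset decI); apply: eq_card => -[f x].
apply/idP/imsetP => [|[t]].
  rewrite inE /= => /and3P[pf /forallP reach /eqP ok].
  have st : size (cycle_encode f x) == n by rewrite size_encode // card_ord.
  exists (Tuple st); last by rewrite /= -ok encodeK.
  rewrite inE /= (all_park_perm (encode_perm reach)) -ok encode_first_repeat // andbT.
  exact: pf.
rewrite inE => /andP[pt rep] E; move: (decP t rep); rewrite -E => -[reach ok eE].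
rewrite inE /= ok eqxx andbT; apply/andP; split; last exact/forallP.
by rewrite /parking_function -(all_park_perm (encode_perm reach)) eE.
Qed.

Lemma connected_count_lt k : 0 < k < n ->
  k * connected_count k + parking_distinct n k.+1 = parking_distinct n k.
Proof.
move=> /andP[k0 kn]; rewrite connected_count_first_repeat ?k0 1?ltnW //.
rewrite /parking_distinct.
rewrite -(cardsID [set t : n.-tuple 'I_n | first_repeat k t]
  [set t : n.-tuple 'I_n | all_park set0 t & uniq (take k t)]).
congr addn; apply: eq_card => t; rewrite !inE /first_repeat size_tuple kn /=.
  by case: (all_park _ _) (uniq (take k t)) => -[].
case us: (uniq (take k.+1 t)); last by case: (uniq _); rewrite ?andbF.
have : uniq (take k (take k.+1 t)) by rewrite take_uniq.
by rewrite take_takel // => ->.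
Qed.

Lemma connected_count_n : 0 < n -> n * connected_count n = parking_distinct n n.
Proof.
move=> n0; rewrite connected_count_first_repeat ?n0 ?leqnn //.
apply: eq_card => t; rewrite !inE /first_repeat size_tuple ltnn andbT //.
Qed.

(** In the difference of consecutive parking counts the factor [n.+1 - (n.+1 - k)] equals [k] and
    cancels the one in front of [connected_count k]. Multiplying by [n.+1 ^ k] avoids division. *)
Lemma connected_countE k : 0 < k < n ->
  n.+1 * connected_count k * n.+1 ^ k = n.+1 ^_ k * n.+1 ^ n.-1.
Proof.
move=> kn; have /andP[k0 kn'] := kn; apply/eqP; rewrite -(eqn_pmul2l k0); apply/eqP.
have := connected_count_lt kn; move/(congr1 (muln n.+1)); rewrite mulnDr.
rewrite (parking_distinctE kn') (parking_distinctE (ltnW kn')) ffactnSr => E.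
have nE : n = (n - k.+1 + k).+1 by lia.
have -> : n.-1 = (n - k.+1) + k by lia.
rewrite expnD !mulnA -[k * _ * _]mulnA; congr (_ * n.+1 ^ k).
move: E; have -> : n - k = (n - k.+1).+1 by lia.
rewrite expnS; have : k <= n.+1 by lia.
move: (n - k.+1) (n.+1 ^_ k) (connected_count k) => d x c.
move=> kn1; have {4}-> : n.+1 = (n.+1 - k) + k by lia.
by move: (n.+1 ^ d) (n.+1 - k) => y z; nia.
Qed.

Lemma connected_countnE : 0 < n ->
  n.+1 * (n * connected_count n) = n.+1 ^_ n.
Proof.
by move=> n0; rewrite connected_count_n // parking_distinctE // subnn expn0 muln1.
Qed.

Lemma cyclic_point_exists (pi : {ffun 'I_n -> 'I_n}) : 0 < n -> exists x, cyclic_point pi x.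
Proof.
case: n pi => // m pi _; have /loopingP := looping_order pi ord0.
move=> /(_ (order pi ord0))/trajectP[i lt_i iE].
exists (iter i pi ord0); apply/cyclic_pointE; apply/(orbitPcycle 3 2).
exists (order pi ord0 - i).-1; rewrite prednK ?subn_gt0 //.
by rewrite -iterD subnK // ltnW.
Qed.

Lemma cyclic_count_gt0 (pi : {ffun 'I_n -> 'I_n}) : 0 < n -> 0 < cyclic_count pi.
Proof.
move=> /(cyclic_point_exists pi)[x cx]; apply/card_gt0P; exists x.
by rewrite inE; apply/asboolP.
Qed.

Lemma cyclic_count_le (pi : {ffun 'I_n -> 'I_n}) : cyclic_count pi <= n.
Proof. by rewrite -[leqRHS]card_ord max_card. Qed.

(** The sum may start at 1 because a self-map of a nonempty finite set has a cycle. *)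
Lemma card_connected_pf_le m : 0 < n ->
  #|[pred pi : connected_pf n | cyclic_count (val pi) <= m]| =
  \sum_(1 <= k < m.+1) connected_count k.
Proof.
move=> n0; transitivity #|[set pi : {ffun 'I_n -> 'I_n} |
    connected_parking_function pi & cyclic_count pi <= m]|.
  rewrite -(card_image val_inj); apply: eq_card => pi; rewrite inE.
  apply/imageP/andP => [[[f cf] /= fm ->]|[cf fm]]; first by split.
  by exists (exist _ pi cf).
elim: m => [|m IH].
  rewrite big_geq //; apply: eq_card0 => pi; rewrite inE leqn0.
  by rewrite -[_ == 0]negbK -lt0n cyclic_count_gt0 // andbF.
rewrite big_nat_recr //= -IH addnC -[in LHS](cardsID [set pi | cyclic_count pi == m.+1]).
congr addn; apply: eq_card => pi; rewrite !inE;
  case: (connected_parking_function pi); rewrite ?andbF //=.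
  by case: eqP => [->|_]; rewrite ?leqnn ?andbF.
by rewrite -ltn_neqAle.
Qed.

End ConnectedCount.

(* Imported only now because [set x | P] and the like denote finite sets above. *)
From mathcomp Require Import finmap.
From mathcomp Require Import all_classical all_reals all_analysis measurable_realfun.
From mathcomp Require Import ring lra.

Import Order.TTheory GRing.Theory Num.Theory.
Import numFieldNormedType.Exports.

Local Open Scope classical_set_scope.
Local Open Scope ring_scope.

(** * Asymptotics of the birthday products *)

Section Birthday.
Variable R : realType.
Implicit Types N m k : nat.

(** The probability that [k] uniform draws from [N] values are distinct. *)
Definition birthday N k : R := (N ^_ k)%:R / N%:R ^+ k.

Lemma birthdayS N k : (k <= N)%N -> (0 < N)%N ->
  birthday N k.+1 = birthday N k * (1 - k%:R / N%:R).
Proof.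
move=> kN N0; rewrite /birthday ffactnSr natrM natrB // exprS.
by field; rewrite -natrX !pnatr_eq0 -!lt0n expn_gt0 N0.
Qed.

Lemma birthday_ge0 N k : 0 <= birthday N k.
Proof. by rewrite /birthday divr_ge0 // exprn_ge0. Qed.

Lemma birthday0 N : birthday N 0 = 1.
Proof. by rewrite /birthday ffactn0 expr0 divr1. Qed.

Lemma birthday1 N : (0 < N)%N -> birthday N 1 = 1.
Proof. by move=> N0; rewrite birthdayS // birthday0 mul0r subr0 mulr1. Qed.

(** Each factor satisfies [1 - x <= expR (- x)], and the exponents add up to [k (k + 1) / (2 N)]. *)
Lemma birthday_le N k : (k < N)%N ->
  birthday N k.+1 <= expR (- (k%:R ^+ 2 / N%:R / 2)).
Proof.
elim: k => [|k IH] kN.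
  by rewrite birthday1 // expr0n /= !mul0r oppr0 expR0.
have N0 : 0 < N%:R :> R by rewrite ltr0n (leq_trans _ kN).
rewrite birthdayS 1?ltnW //; last by apply: leq_trans kN.
have k1 : 1 - k.+1%:R / N%:R <= expR (- (k.+1%:R / N%:R)) :> R by apply: expR_ge1Dx.
apply: le_trans (ler_pM (birthday_ge0 _ _) _ (IH (ltnW kN)) k1) _.
  by rewrite subr_ge0 ler_pdivrMr // mul1r ler_nat ltnW.
rewrite -expRD ler_expR -opprD lerN2 -(natr1 k) -subr_ge0.
have -> : k%:R ^+ 2 / N%:R / 2 + (k%:R + 1) / N%:R - (k%:R + 1) ^+ 2 / N%:R / 2
  = N%:R^-1 / 2 :> R by field; rewrite gt_eqF.
by rewrite divr_ge0 // invr_ge0 ltW.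
Qed.

(** [1 - k / N] is the inverse of [1 + k / (N - k)], hence at least [expR (- (k / (N - k)))]; then
    [N - k] is replaced by the smaller [N - m]. *)
Lemma birthday_ge N m k : (m < N)%N -> (k <= m)%N ->
  expR (- (k%:R ^+ 2 / (N - m)%:R / 2)) <= birthday N k.
Proof.
move=> mN; have N0 : (0 < N)%N by apply: leq_trans mN.
have M0 : 0 < (N - m)%:R :> R by rewrite ltr0n subn_gt0.
elim: k => [|k IH] km; first by rewrite birthday0 expr0n /= !mul0r oppr0 expR0.
have kN : (k < N)%N by apply: leq_ltn_trans mN; exact: ltnW.
have Nk : 0 < N%:R - k%:R :> R by rewrite subr_gt0 ltr_nat.
have MNk : (N - m)%:R <= N%:R - k%:R :> R.
  by rewrite natrB 1?ltnW // lerD2l lerN2 ler_nat ltnW.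
rewrite (birthdayS (ltnW kN) N0).
have k1 : expR (- (k%:R / (N - m)%:R)) <= 1 - k%:R / N%:R :> R.
  apply: (@le_trans _ _ (expR (- (k%:R / (N%:R - k%:R))))).
    by rewrite ler_expR lerN2 ler_wpM2l // lef_pV2 ?posrE.
  have -> : 1 - k%:R / N%:R = (1 + k%:R / (N%:R - k%:R))^-1 :> R.
    field; rewrite subrK ?pnatr_eq0 -?lt0n ?N0 ?gt_eqF //=.
  rewrite expRN lef_pV2 ?posrE ?expR_gt0 ?expR_ge1Dx //.
  by rewrite ltr_wpDr // divr_ge0 // ltW.
apply: le_trans (ler_pM (expR_ge0 _) (expR_ge0 _) (IH (ltnW km)) k1).
rewrite -expRD ler_expR -opprD lerN2 -(natr1 k) -subr_ge0.
have -> : (k%:R + 1) ^+ 2 / (N - m)%:R / 2 - (k%:R ^+ 2 / (N - m)%:R / 2 + k%:R / (N - m)%:R)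
  = (N - m)%:R^-1 / 2 :> R by field; rewrite gt_eqF.
by rewrite divr_ge0 // invr_ge0 ltW.
Qed.

(** * Comparison of birthday sums with a distribution function *)

Definition birthday_sum N m : R := \sum_(1 <= k < m.+1) birthday N k.

Lemma birthday_sumS N m : birthday_sum N m.+1 = birthday_sum N m + birthday N m.+1.
Proof. by rewrite /birthday_sum big_nat_recr. Qed.

Lemma birthday_sum_le N m1 m2 : (m1 <= m2)%N -> birthday_sum N m1 <= birthday_sum N m2.
Proof.
move=> m12; rewrite /birthday_sum [leRHS](big_cat_nat _ (n := m1.+1)) //=.
by rewrite lerDl sumr_ge0 // => k _; exact: birthday_ge0.
Qed.

(* [Phi] will be the distribution function of |N(0,1)|, and [c] twice the
   peak of the normal density. *)
Variables (Phi : R -> R) (c : R).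
Hypothesis c0 : 0 < c.
Hypothesis Phi0 : Phi 0 = 0.
Hypothesis Phi_le1 : forall x : R, Phi x <= 1.
Hypothesis Phi_ub : forall a b : R, 0 <= a -> a <= b ->
  Phi b - Phi a <= c * expR (- (a ^+ 2 / 2)) * (b - a).
Hypothesis Phi_lb : forall a b : R, 0 <= a -> a <= b ->
  c * expR (- (b ^+ 2 / 2)) * (b - a) <= Phi b - Phi a.
Hypothesis Phi_cvg : Phi x @[x --> +oo] --> (1 : R).

Lemma Phi_le (a b : R) : 0 <= a -> a <= b -> Phi a <= Phi b.
Proof.
move=> a0 ab; rewrite -subr_ge0; apply: le_trans (Phi_lb a0 ab).
by rewrite !mulr_ge0 ?expR_ge0 ?subr_ge0 // ltW.
Qed.

Lemma Phi_lip (a b : R) : 0 <= a -> a <= b -> Phi b - Phi a <= c * (b - a).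
Proof.
move=> a0 ab; apply: le_trans (Phi_ub a0 ab) _.
rewrite ler_wpM2r ?subr_ge0 // ler_piMr ?(ltW c0) // -[leRHS]expR0 ler_expR oppr_le0.
by rewrite divr_ge0 // sqr_ge0.
Qed.

Lemma Phi_ge0 a : 0 <= a -> 0 <= Phi a.
Proof. by move=> a0; rewrite -Phi0 Phi_le. Qed.

Lemma sqrtN_gt0 N : (0 < N)%N -> 0 < Num.sqrt N%:R :> R.
Proof. by move=> N0; rewrite sqrtr_gt0 ltr0n. Qed.

(** From the second on, each term is bounded by an increment of [Phi] over a step of length
    [1 / sqrt N], and these telescope. The first term accounts for the additive [c]. *)
Lemma birthday_sum_ub N m : (0 < N)%N -> (m <= N)%N ->
  c * birthday_sum N m <= c + Num.sqrt N%:R * Phi (m%:R / Num.sqrt N%:R).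
Proof.
move=> N0; have s0 := sqrtN_gt0 N0.
have sN : Num.sqrt N%:R ^+ 2 = N%:R :> R by rewrite sqr_sqrtr.
have main k : (k < N)%N ->
    c * birthday_sum N k.+1 <= c + Num.sqrt N%:R * Phi (k%:R / Num.sqrt N%:R).
  elim: k => [|k IH] kN.
    by rewrite /birthday_sum big_nat1 birthday1 // mul0r Phi0 mulr0 addr0 mulr1.
  rewrite birthday_sumS mulrDr; have := IH (ltnW kN) => {}IH.
  have k0 : 0 <= k%:R / Num.sqrt N%:R :> R by rewrite divr_ge0 // ltW.
  have kk : k%:R / Num.sqrt N%:R <= k.+1%:R / Num.sqrt N%:R :> R.
    by rewrite ler_pM2r ?invr_gt0 // ler_nat.
  have := Phi_lb k0 kk; rewrite -mulrBl -natrB // subSnn mul1r => lb.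
  have {lb} : c * birthday N k.+2 <=
      Num.sqrt N%:R * (Phi (k.+1%:R / Num.sqrt N%:R) - Phi (k%:R / Num.sqrt N%:R)).
    rewrite -ler_pdivrMl //; apply: le_trans lb.
    rewrite [leLHS]mulrC ler_pM2r ?invr_gt0 // ler_pM2l //.
    by rewrite expr_div_n sN; apply: birthday_le.
  lra.
case: m => [|m] mN.
  by rewrite /birthday_sum big_geq // mulr0 mul0r Phi0 mulr0 addr0 ltW.
apply: le_trans (main m mN) _; rewrite lerD2l ler_pM2l //; apply: Phi_le.
  by rewrite divr_ge0 // ltW.
by rewrite ler_pM2r ?invr_gt0 // ler_nat.
Qed.

(** The same telescoping with the step adapted to the exponent in [birthday_ge]. It starts at one
    step instead of 0, which costs at most [c] by the Lipschitz bound. *)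
Lemma birthday_sum_lb N m : (m < N)%N ->
  Num.sqrt (N - m)%:R * Phi (m%:R / Num.sqrt (N - m)%:R) - c <= c * birthday_sum N m.
Proof.
move=> mN; have M0 : (0 < N - m)%N by rewrite subn_gt0.
have s0 := sqrtN_gt0 M0.
have sN : Num.sqrt (N - m)%:R ^+ 2 = (N - m)%:R :> R by rewrite sqr_sqrtr.
move: (Num.sqrt _) s0 sN => s s0 sN.
have main k : (k <= m)%N ->
    s * (Phi (k.+1%:R / s) - Phi s^-1) <= c * birthday_sum N k.
  elim: k => [|k IH] km.
    by rewrite /birthday_sum big_geq // mul1r subrr !mulr0.
  rewrite birthday_sumS [leRHS]mulrDr; have := IH (ltnW km) => {}IH.
  have k0 : 0 <= k.+1%:R / s :> R by rewrite divr_ge0 // ltW.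
  have kk : k.+1%:R / s <= k.+2%:R / s :> R.
    by rewrite ler_pM2r ?invr_gt0 // ler_nat.
  have := Phi_ub k0 kk; rewrite -mulrBl -natrB // subSnn mul1r => ub.
  have {ub} : s * (Phi (k.+2%:R / s) - Phi (k.+1%:R / s)) <= c * birthday N k.+1.
    rewrite -ler_pdivlMl //; apply: le_trans ub _.
    rewrite [leRHS]mulrC ler_pM2r ?invr_gt0 // ler_pM2l // expr_div_n sN.
    exact: birthday_ge.
  lra.
apply: le_trans (main m (leqnn m)).
have m0 : 0 <= m%:R / s by rewrite divr_ge0 // ltW.
have i0 : 0 <= s^-1 by rewrite invr_ge0 ltW.
have : s * Phi (m%:R / s) <= s * Phi (m.+1%:R / s).
  by rewrite ler_pM2l // Phi_le // ler_pM2r ?invr_gt0 // ler_nat.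
have : s * Phi s^-1 <= c.
  rewrite -ler_pdivlMl //; have := Phi_lip (lexx 0) i0.
  by rewrite Phi0 !subr0 mulrC.
lra.
Qed.

Lemma sqrtSS_le n : Num.sqrt n.+2%:R <= Num.sqrt n.+1%:R + (Num.sqrt n.+1%:R)^-1 :> R.
Proof.
have w0 := @sqrtN_gt0 n.+1 isT; set w := Num.sqrt n.+1%:R in w0 *.
have wi : 0 < w^-1 by rewrite invr_gt0.
rewrite -(@ler_pXn2r _ 2) ?nnegrE ?sqrtr_ge0 ?addr_ge0 1?ltW //.
rewrite sqr_sqrtr // sqrrD sqr_sqrtr // mulfV ?gt_eqF // -natr1.
by have := sqr_ge0 w^-1; lra.
Qed.

Lemma inv_sqrt_le1 n : (Num.sqrt n.+1%:R)^-1 <= 1 :> R.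
Proof.
by rewrite invf_le1 ?sqrtN_gt0 // -[leLHS]sqrtr1 ler_sqrt // ler1n.
Qed.

Lemma truncn_sqrt_le (r : R) n : 0 <= r -> r <= Num.sqrt n.+1%:R ->
  (Num.truncn (r * Num.sqrt n.+1%:R) <= n.+1)%N.
Proof.
move=> r0 rw; rewrite -(@ler_nat R).
apply: (@le_trans _ _ (r * Num.sqrt n.+1%:R)).
  by rewrite truncn_le mulr_ge0 // sqrtr_ge0.
by rewrite -[leRHS]sqr_sqrtr // expr2 ler_wpM2r // sqrtr_ge0.
Qed.

(** Length [n.+1] means [N = n.+2]. The error combines the [c] of [birthday_sum_ub] with replacing
    [sqrt n.+2] by [sqrt n.+1 + 1]. *)
Lemma scaled_sum_ub (r : R) n : 0 <= r -> r <= Num.sqrt n.+1%:R ->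
  c * birthday_sum n.+2 (Num.truncn (r * Num.sqrt n.+1%:R)) / Num.sqrt n.+1%:R
  <= Phi r + (c + 1) / Num.sqrt n.+1%:R.
Proof.
move=> r0 rw; have := truncn_sqrt_le r0 rw.
have w0 := @sqrtN_gt0 n.+1 isT; have rw0 : 0 <= r * Num.sqrt n.+1%:R by rewrite mulr_ge0 // ltW.
have := truncn_le (r * Num.sqrt n.+1%:R); rewrite rw0.
move: (Num.truncn _) => m mr mn.
have s0 := @sqrtN_gt0 n.+2 isT.
have ub := @birthday_sum_ub n.+2 m isT (leqW mn).
have Pm : Phi (m%:R / Num.sqrt n.+2%:R) <= Phi r.
  apply: Phi_le; first by rewrite divr_ge0 // ltW.
  rewrite ler_pdivrMr //; apply: le_trans mr _.
  by rewrite ler_wpM2l // ler_sqrt // ler_nat.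
rewrite ler_pdivrMr // mulrDl divfK ?gt_eqF //; apply: le_trans ub _.
have := sqrtSS_le n; have := inv_sqrt_le1 n; move: (Num.sqrt n.+1%:R)^-1 => u u1 ssu.
have : Num.sqrt n.+2%:R * Phi (m%:R / Num.sqrt n.+2%:R) <= (Num.sqrt n.+1%:R + 1) * Phi r.
  apply: ler_pM => //; first by rewrite Phi_ge0 // divr_ge0 // ltW.
  by apply: le_trans ssu _; rewrite lerD2l.
by have := Phi_le1 r; lra.
Qed.

(** The error has three sources: [c] from [birthday_sum_lb], another [c] from the truncation, and
    [r] from [sqrt (n.+2 - m) >= sqrt n.+1 - r]. *)
Lemma scaled_sum_lb (r : R) n : 0 <= r -> r <= Num.sqrt n.+1%:R ->
  Phi r - (2 * c + r) / Num.sqrt n.+1%:R <=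
  c * birthday_sum n.+2 (Num.truncn (r * Num.sqrt n.+1%:R)) / Num.sqrt n.+1%:R.
Proof.
move=> r0 rw; have := truncn_sqrt_le r0 rw.
have w0 := @sqrtN_gt0 n.+1 isT; have rw0 : 0 <= r * Num.sqrt n.+1%:R by rewrite mulr_ge0 // ltW.
have := truncn_le (r * Num.sqrt n.+1%:R); rewrite rw0.
have := truncnS_gt (r * Num.sqrt n.+1%:R).
move: (Num.truncn _) => m rm mr mn.
have mN : (m < n.+2)%N by [].
have M0 : (0 < n.+2 - m)%N by rewrite subn_gt0.
have lb := @birthday_sum_lb n.+2 m mN.
have s0 := sqrtN_gt0 M0.
have w2 : Num.sqrt n.+1%:R ^+ 2 = n.+1%:R :> R by rewrite sqr_sqrtr.
have sw : Num.sqrt n.+1%:R - r <= Num.sqrt (n.+2 - m)%:R :> R.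
  rewrite -(@ler_pXn2r _ 2) ?nnegrE ?sqrtr_ge0 ?subr_ge0 //.
  rewrite [leRHS]sqr_sqrtr // natrB 1?ltnW // -[n.+2%:R]natr1 sqrrB w2.
  have : r ^+ 2 <= r * Num.sqrt n.+1%:R by rewrite expr2 ler_wpM2l.
  by move: (Num.sqrt _) mr => w; lra.
have Pm : Phi r - c / Num.sqrt n.+1%:R <= Phi (m%:R / Num.sqrt (n.+2 - m)%:R).
  have u0 : 0 < (Num.sqrt n.+1%:R)^-1 :> R by rewrite invr_gt0.
  (* Truncation moves the argument by at most [1 / sqrt n.+1]. For smaller [r] the left side is not
     positive. *)
  have [ru|ru] := leP r (Num.sqrt n.+1%:R)^-1.
    apply: (@le_trans _ _ 0); last by rewrite Phi_ge0 // divr_ge0 // ltW.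
    rewrite subr_le0; have := Phi_lip (lexx 0) r0; rewrite Phi0 !subr0 => /le_trans; apply.
    by rewrite ler_pM2l.
  have ru0 : 0 <= r - (Num.sqrt n.+1%:R)^-1 by rewrite subr_ge0 ltW.
  have ru1 : r - (Num.sqrt n.+1%:R)^-1 <= r by rewrite gerBl ltW.
  have := Phi_lip ru0 ru1; rewrite subKr => lip.
  apply: (@le_trans _ _ (Phi (r - (Num.sqrt n.+1%:R)^-1))); first by lra.
  apply: Phi_le => //; rewrite ler_pdivlMr //.
  (* Positivity of [m] gives [n.+2 - m <= n.+1], so dividing by [sqrt n.+1] only decreases the
     argument. *)
  have m0 : (0 < m)%N.
    rewrite -(ltr_nat R); rewrite -[X in _ < X](addrK 1) natr1 subr_gt0.
    apply: le_lt_trans rm; rewrite -ler_pdivrMr // div1r ltW //.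
  apply: (@le_trans _ _ ((r - (Num.sqrt n.+1%:R)^-1) * Num.sqrt n.+1%:R)).
    by rewrite ler_wpM2l // ler_sqrt // ler_nat leq_subLR -add1n leq_add2r.
  by rewrite mulrBl mulVf ?gt_eqF // lerBlDr natr1 ltW.
rewrite ler_pdivlMr // mulrBl divfK ?gt_eqF //; apply: le_trans lb.
have : (Num.sqrt n.+1%:R - r) * (Phi r - c / Num.sqrt n.+1%:R) <=
    Num.sqrt (n.+2 - m)%:R * Phi (m%:R / Num.sqrt (n.+2 - m)%:R).
  apply: (@le_trans _ _ ((Num.sqrt n.+1%:R - r) * Phi (m%:R / Num.sqrt (n.+2 - m)%:R))).
    by rewrite ler_wpM2l // subr_ge0.
  by rewrite ler_wpM2r // Phi_ge0 // divr_ge0 // ltW.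
have -> : (Num.sqrt n.+1%:R - r) * (Phi r - c / Num.sqrt n.+1%:R) =
  Num.sqrt n.+1%:R * Phi r - r * Phi r - c + r * (c / Num.sqrt n.+1%:R).
  by field; rewrite gt_eqF.
have : 0 <= r * (c / Num.sqrt n.+1%:R) by rewrite mulr_ge0 // divr_ge0 // ltW.
have : r * Phi r <= r by rewrite ler_piMr.
lra.
Qed.

(** Proportional to the number of all connected parking functions of length [n.+1]; the last summand
    corrects the exceptional top term. *)
Definition total_sum n : R := birthday_sum n.+2 n.+1 + birthday n.+2 n.+1 / n.+1%:R.

Lemma scaled_total_ub n :
  c * total_sum n / Num.sqrt n.+1%:R <= 1 + (2 * c + 1) / Num.sqrt n.+1%:R.
Proof.
have w0 := @sqrtN_gt0 n.+1 isT.
rewrite ler_pdivrMr // mulrDl divfK ?gt_eqF // /total_sum mulrDr.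
have ub := @birthday_sum_ub n.+2 n.+1 isT (leqnSn _).
have : Num.sqrt n.+2%:R * Phi (n.+1%:R / Num.sqrt n.+2%:R) <= Num.sqrt n.+1%:R + 1.
  apply: (@le_trans _ _ (Num.sqrt n.+2%:R)); first by rewrite ler_piMr // sqrtr_ge0.
  by apply: le_trans (sqrtSS_le n) _; rewrite lerD2l inv_sqrt_le1.
have : c * (birthday n.+2 n.+1 / n.+1%:R) <= c.
  rewrite ler_piMr ?(ltW c0) // ler_pdivrMr // mul1r.
  have bn : birthday n.+2 n.+1 <= 1.
    apply: (le_trans (@birthday_le n.+2 n (leqnSn _))).
    by rewrite -[leRHS]expR0 ler_expR oppr_le0 !divr_ge0 // sqr_ge0.
  by apply: le_trans bn _; rewrite ler1n.
move: ub; set x := c * birthday_sum _ _; set y := c * (_ / _).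
by set z := Num.sqrt n.+2%:R * _; clearbody x y z; lra.
Qed.

Lemma birthday_sum_le_total n m : (m <= n.+1)%N -> birthday_sum n.+2 m <= total_sum n.
Proof.
move=> mn; apply: le_trans (birthday_sum_le _ mn) _.
by rewrite lerDl divr_ge0 // birthday_ge0.
Qed.

Lemma cvg_inv_sqrt : (Num.sqrt n.+1%:R)^-1 @[n --> \oo] --> (0 : R).
Proof.
have -> : (fun n => (Num.sqrt n.+1%:R)^-1) = Num.sqrt \o (@harmonic R).
  by apply/funext => n /=; rewrite /harmonic sqrtrV.
rewrite -[X in _ --> X](@sqrtr0 R).
exact: (continuous_cvg _ (@sqrt_continuous R 0) cvg_harmonic).
Qed.

Lemma near_le_sqrt (r : R) : \forall n \near \oo, r <= Num.sqrt n.+1%:R :> R.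
Proof.
have [r0|r0] := leP r 0; first by apply: nearW => n; apply: le_trans r0 (sqrtr_ge0 _).
have /cvgr_lt/(_ r^-1) := cvg_inv_sqrt; rewrite invr_gt0 => /(_ r0).
apply: filterS => n; rewrite ltf_pV2 ?posrE ?sqrtN_gt0 // => /ltW //.
Qed.

Lemma cvg_scaled_sum (r : R) : 0 <= r ->
  c * birthday_sum n.+2 (Num.truncn (r * Num.sqrt n.+1%:R)) / Num.sqrt n.+1%:R
    @[n --> \oo] --> Phi r.
Proof.
move=> r0.
apply: (@squeeze_cvgr _ _ _ _ (fun n => Phi r - (2 * c + r) / Num.sqrt n.+1%:R)
  (fun n => Phi r + (c + 1) / Num.sqrt n.+1%:R)).
- by apply: filterS (near_le_sqrt r) => n rw; rewrite scaled_sum_lb ?scaled_sum_ub.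
- rewrite -[X in _ --> X]subr0 -[X in _ - X](mulr0 (2 * c + r)).
  apply: cvgB; first exact: cvg_cst.
  by apply: cvgM; [exact: cvg_cst|exact: cvg_inv_sqrt].
- suff : (Phi r + (c + 1) / Num.sqrt n.+1%:R) @[n --> \oo] --> Phi r + (c + 1) * 0.
    by rewrite mulr0 addr0.
  apply: cvgD; first exact: cvg_cst.
  by apply: cvgM; [exact: cvg_cst|exact: cvg_inv_sqrt].
Qed.

(** For the lower bound the sum is cut at a fixed multiple [y] of [sqrt n.+1] with [Phi y] close to
    1, since the error in [scaled_sum_lb] grows with its argument. *)
Lemma cvg_scaled_total : c * total_sum n / Num.sqrt n.+1%:R @[n --> \oo] --> (1 : R).
Proof.
apply/cvgrPdist_le => e e0.
have [y [y0 Py]] : exists y, 0 <= y /\ 1 - e / 2 <= Phi y.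
  have /cvgrPdist_le/(_ (e / 2)) := Phi_cvg; rewrite divr_gt0 // => /(_ isT) P.
  near +oo_R => y; exists y; split; first by near: y; apply: nbhs_pinfty_ge; rewrite num_real.
  have : `|1 - Phi y| <= e / 2 by near: y.
  by rewrite ler_norml => /andP[_]; lra.
have lim D : 0 < D -> \forall n \near \oo, D / Num.sqrt n.+1%:R <= e / 2 :> R.
  move=> D0; have /cvgr_lt/(_ (e / 2 / D)) := cvg_inv_sqrt; rewrite !divr_gt0 // => /(_ isT).
  by apply: filterS => n /ltW; rewrite ler_pdivlMr // mulrC.
near=> n.
have ub := scaled_total_ub n.
have yw : y <= Num.sqrt n.+1%:R by near: n; exact: near_le_sqrt.
have lb := scaled_sum_lb y0 yw.
have {lb} : Phi y - (2 * c + y) / Num.sqrt n.+1%:R <= c * total_sum n / Num.sqrt n.+1%:R.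
  apply: le_trans lb _; rewrite ler_pM2r ?invr_gt0 ?sqrtN_gt0 // ler_pM2l //.
  by apply: birthday_sum_le_total; exact: truncn_sqrt_le.
have : (2 * c + 1) / Num.sqrt n.+1%:R <= e / 2.
  by near: n; apply: lim; rewrite ltr_wpDl // mulr_ge0 // ltW.
have : (2 * c + y) / Num.sqrt n.+1%:R <= e / 2.
  by near: n; apply: lim; rewrite ltr_wpDr // mulr_gt0.
rewrite ler_norml => h1 h2 h3; lra.
Unshelve. all: by end_near.
Qed.

Lemma cvg_birthday_ratio (r : R) : 0 <= r ->
  birthday_sum n.+2 (Num.truncn (r * Num.sqrt n.+1%:R)) / total_sum n
    @[n --> \oo] --> Phi r.
Proof.
move=> r0; rewrite -[Phi r]divr1.
have -> : (fun n => birthday_sum n.+2 (Num.truncn (r * Num.sqrt n.+1%:R)) / total_sum n) =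
  (fun n => (c * birthday_sum n.+2 (Num.truncn (r * Num.sqrt n.+1%:R)) / Num.sqrt n.+1%:R)
    / (c * total_sum n / Num.sqrt n.+1%:R)).
  apply/funext => n; have w0 := @sqrtN_gt0 n.+1 isT.
  have T0 : 0 < total_sum n.
    apply: (@lt_le_trans _ _ (birthday_sum n.+2 1)); last exact: birthday_sum_le_total.
    by rewrite /birthday_sum big_nat1 birthday1.
  by field; rewrite !gt_eqF.
apply: cvgM; first exact: cvg_scaled_sum.
by apply: cvgV; [rewrite oner_eq0|exact: cvg_scaled_total].
Qed.

End Birthday.

(** * The limit law *)

Section FoldedNormal.
Variable R : realType.
Local Notation mu := (@lebesgue_measure R).
Local Notation normal := (normal_prob (0 : R) 1).

Lemma normal_prob_bounds (A : set R) (l u : R) : measurable A -> 0 <= l ->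
  (forall x, A x -> l <= normal_pdf 0 1 x <= u) ->
  (l%:E * mu A <= normal A <= u%:E * mu A)%E.
Proof.
move=> mA l0 lu; rewrite -!integral_cst // /normal_prob.
have mpdf : measurable_fun A (EFin \o normal_pdf (0 : R) 1).
  apply/measurable_EFinP; apply: measurable_funTS; exact: measurable_normal_pdf.
apply/andP; split; apply: ge0_le_integral => //= x Ax; rewrite lee_fin.
- by have /andP[] := lu _ Ax.
- exact: normal_pdf_ge0.
- by have /andP[] := lu _ Ax.
Qed.

Definition folded_normal_cdf (r : R) : R :=
  fine (cdf (abs_value R : {RV normal >-> R}) r).

Lemma folded_normal_cdfE r :
  (folded_normal_cdf r)%:E = normal [set x | `|x| <= r].
Proof.
by rewrite /folded_normal_cdf fineK ?fin_num_measure.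
Qed.

Lemma folded_normal_cdf_lt0 r : r < 0 -> folded_normal_cdf r = 0.
Proof.
move=> r0; apply: EFin_inj; rewrite folded_normal_cdfE.
rewrite (_ : [set x | _] = set0) ?measure0 // -subset0 => x /= xr.
by have := le_lt_trans xr r0; rewrite normr_lt0.
Qed.

Lemma folded_normal_cdf0 : folded_normal_cdf 0 = 0.
Proof.
apply: EFin_inj; rewrite folded_normal_cdfE.
have -> : [set x : R | `|x| <= 0] = [set` `[0, 0]].
  by apply/seteqP; split => x /=; rewrite normr_le0 in_itv /= -eq_le eq_sym.
set Z := [set` _].
have m0 : measurable Z by exact: measurable_itv.
have /andP[_] : (0%R%:E * mu Z <= normal Z <= (normal_peak 1)%:E * mu Z)%E.
  by apply: normal_prob_bounds => // x _; rewrite normal_pdf_ge0 normal_pdf_ub ?oner_neq0.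
rewrite /Z lebesgue_measure_itv /= lte_fin ltxx mule0 => h.
by apply/eqP; rewrite eq_le h measure_ge0.
Qed.

Lemma normal_pdf01 (x : R) : normal_pdf 0 1 x = normal_peak 1 * expR (- (x ^+ 2 / 2)).
Proof.
by rewrite normal_pdfE ?oner_neq0 // /normal_fun subr0 expr1n mulNr mulr2n.
Qed.

(** The increment is the normal mass of two symmetric intervals of length [b - a], on which the
    density lies between its values at [b] and [a]. *)
Lemma folded_normal_cdf_bounds (a b : R) : 0 <= a -> a <= b ->
  2 * normal_peak 1 * expR (- (b ^+ 2 / 2)) * (b - a) <=
    folded_normal_cdf b - folded_normal_cdf a <=
  2 * normal_peak 1 * expR (- (a ^+ 2 / 2)) * (b - a).
Proof.
move=> a0 ab.
have pdfP (x : R) : a <= `|x| -> `|x| <= b ->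
    normal_peak 1 * expR (- (b ^+ 2 / 2)) <= normal_pdf 0 1 x <=
    normal_peak 1 * expR (- (a ^+ 2 / 2)).
  move=> ax xb; rewrite normal_pdf01 -(real_normK (num_real x)).
  have p0 : 0 < normal_peak (1 : R) by rewrite normal_peak_gt0 ?oner_neq0.
  rewrite !ler_pM2l // !ler_expR !lerN2 !ler_pM2r ?invr_gt0 //.
  by rewrite !ler_pXn2r ?nnegrE ?(le_trans a0 ab) // xb ax.
pose lo : R := normal_peak 1 * expR (- (b ^+ 2 / 2)).
pose hi : R := normal_peak 1 * expR (- (a ^+ 2 / 2)).
have na0 : - a <= 0 by rewrite oppr_le0.
have l0 : 0 <= lo by rewrite mulr_ge0 ?expR_ge0 ?normal_peak_ge0.
(* Half-open, so that they are disjoint from [[- a, a]] and complete it to [[- b, b]]. *)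
pose A1 : set R := [set` `]a, b]]; pose A2 : set R := [set` `[- b, - a[].
have mA1 : measurable A1 by exact: measurable_itv.
have mA2 : measurable A2 by exact: measurable_itv.
have [/andP[l1 u1] /andP[l2 u2]] :
    (lo%:E * mu A1 <= normal A1 <= hi%:E * mu A1)%E /\
    (lo%:E * mu A2 <= normal A2 <= hi%:E * mu A2)%E.
  split; apply: normal_prob_bounds => // x; rewrite /A1 /A2 /= in_itv /=
    => /andP[h1 h2]; apply: pdfP.
  - by rewrite (ger0_norm (ltW (le_lt_trans a0 h1))) ltW.
  - by rewrite (ger0_norm (ltW (le_lt_trans a0 h1))).
  - by rewrite ltr0_norm 1?lerNr; [exact: ltW|exact: lt_le_trans h2 na0].
  - by rewrite ltr0_norm 1?lerNl //; exact: lt_le_trans h2 na0.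
have split_b : [set x : R | `|x| <= b] =
    [set x : R | `|x| <= a] `|` (A1 `|` A2).
  apply/seteqP; split => x; rewrite /A1 /A2 /= !in_itv /=.
    move=> xb; have [xa|ax] := leP `|x| a; [by left|right].
    move: xb ax; rewrite ler_norml lter_normr => /andP[-> ->] /orP[->|ax]; [by left|right].
    by rewrite ltrNr ax.
  move=> [xa|[/andP[h1 h2]|/andP[h1 h2]]]; first exact: le_trans ab.
    by rewrite (ger0_norm (ltW (le_lt_trans a0 h1))).
  by rewrite ltr0_norm 1?lerNl //; exact: lt_le_trans h2 na0.
have mle r : measurable [set x : R | `|x| <= r].
  rewrite (_ : mkset _ = [set` `[- r, r]]); first exact: measurable_itv.
  by apply/seteqP; split => x /=; rewrite in_itv /= ler_norml.
have cdf_b : (folded_normal_cdf b)%:E =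
    ((folded_normal_cdf a)%:E + (normal A1 + normal A2))%E.
  rewrite !folded_normal_cdfE split_b measureU; last 3 first.
  - exact: mle.
  - exact: measurableU.
  - rewrite -subset0 => x [/= xa]; rewrite /A1 /A2 /= !in_itv /= => -[|] /andP[h1 h2].
      by have := le_trans (ler_norm x) xa; rewrite leNgt h1.
    by move: xa; rewrite ler_norml leNgt h2.
  rewrite measureU // -subset0 => x []; rewrite /A1 /A2 /= !in_itv /= => /andP[h1 _] /andP[_ h2].
  lra.
have muA1 : mu A1 = (b - a)%:E.
  rewrite lebesgue_measure_itv /= lte_fin; case: ltP => // ba.
  by rewrite (le_anti (_ : a <= b <= a)) ?ab ?ba // subrr.
have muA2 : mu A2 = (b - a)%:E.
  rewrite lebesgue_measure_itv /= lte_fin ltrN2; case: ltP => ba.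
    by rewrite opprK addrC.
  by rewrite (le_anti (_ : a <= b <= a)) ?ab ?ba // subrr.
have [x1 E1] : exists x1, normal A1 = x1%:E.
  by exists (fine (normal A1)); rewrite fineK //; exact: fin_num_measure.
have [x2 E2] : exists x2, normal A2 = x2%:E.
  by exists (fine (normal A2)); rewrite fineK //; exact: fin_num_measure.
move: cdf_b l1 u1 l2 u2; rewrite muA1 muA2 E1 E2 -!EFinM -!EFinD => -[->].
by rewrite !lee_fin /lo /hi => l1 u1 l2 u2; apply/andP; split; lra.
Qed.

Lemma folded_normal_cdf_le1 r : folded_normal_cdf r <= 1.
Proof.
rewrite -lee_fin /folded_normal_cdf fineK ?fin_num_measure //.
exact: cdf_le1.
Qed.

Lemma cvg_folded_normal_cdf : folded_normal_cdf x @[x --> +oo] --> (1 : R).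
Proof.
have cy := cvg_cdfy1 (abs_value R : {RV normal >-> R}).
exact: (fine_cvg cy).
Qed.

End FoldedNormal.

(** * The law of the number of cyclic points *)

Section UniformConnected.
Variable R : realType.

Lemma uniform_connected_pfE n (P : pred (connected_pf n.+1)) :
  uniform_connected_pf R n [set pi | P pi] =
  (#|P|%:R / #|{: connected_pf n.+1}|%:R)%:E.
Proof.
rewrite /uniform_connected_pf /mscale /= /counting asboolT; last exact: finite_finset.
rewrite -EFinM mulrC; congr ((_%:R / _)%:E).
have -> : [set pi | P pi] = [set` [fset x | x in P]%fset].
  apply/seteqP; split => x /=; first by move=> Px; apply/imfsetP; exists x.
  by case/imfsetP => y /= Py ->.
by rewrite set_fsetK card_imfset //= -cardE.
Qed.

Lemma connected_count_birthday n k : (0 < k < n.+1)%N ->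
  (connected_count n.+1 k)%:R =
  n.+2%:R ^+ n / n.+2%:R * birthday R n.+2 k.
Proof.
move=> kn; have := connected_countE kn => /(congr1 (fun m => m%:R : R)).
rewrite !natrM !natrX /= => E; rewrite /birthday.
have N0 : n.+2%:R != 0 :> R by rewrite pnatr_eq0.
have Nk : n.+2%:R ^+ k != 0 :> R by rewrite expf_neq0.
apply: (mulfI N0); apply: (mulIf Nk); rewrite E.
by move: n.+2%:R N0 {Nk E} => N N0; field; rewrite ?expf_neq0 ?N0.
Qed.

(** The top count carries the extra factor [n.+2 / n.+1], split as [1 + 1 / n.+1] to match
    [total_sum]. *)
Lemma connected_count_birthday_last n :
  (connected_count n.+1 n.+1)%:R =
  n.+2%:R ^+ n / n.+2%:R * (birthday R n.+2 n.+1 + birthday R n.+2 n.+1 / n.+1%:R).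
Proof.
have E : n.+2%:R * (n.+1%:R * (connected_count n.+1 n.+1)%:R) =
    (n.+2 ^_ n.+1)%:R :> R by rewrite -!natrM connected_countnE.
rewrite /birthday -E exprS.
have NE : n.+2%:R = n.+1%:R + 1 :> R by rewrite natr1.
have N0 : n.+2%:R != 0 :> R by rewrite pnatr_eq0.
have p0 : n.+1%:R != 0 :> R by rewrite pnatr_eq0.
move: n.+1%:R n.+2%:R (connected_count _ _)%:R NE N0 p0 {E} => p N x NE N0 p0.
have -> : N ^+ n / N * (N * (p * x) / (N * N ^+ n) + N * (p * x) / (N * N ^+ n) / p)
  = x * (p + 1) / N by field; rewrite N0 p0 expf_neq0.
by rewrite -NE mulfK.
Qed.

Lemma sum_connected_count n m : (m < n.+1)%N ->
  (\sum_(1 <= k < m.+1) connected_count n.+1 k)%:R =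
  n.+2%:R ^+ n / n.+2%:R * birthday_sum R n.+2 m.
Proof.
move=> mn; rewrite natr_sum /birthday_sum big_distrr /=; apply: eq_big_nat => k /andP[k0 km].
by rewrite connected_count_birthday // k0 (leq_trans km).
Qed.

Lemma sum_connected_count_total n :
  (\sum_(1 <= k < n.+2) connected_count n.+1 k)%:R =
  n.+2%:R ^+ n / n.+2%:R * total_sum R n.
Proof.
rewrite big_nat_recr //= natrD sum_connected_count // connected_count_birthday_last.
by rewrite -mulrDr /total_sum birthday_sumS addrA.
Qed.

Lemma card_connected_pf n :
  #|{: connected_pf n.+1}| = (\sum_(1 <= k < n.+2) connected_count n.+1 k)%N.
Proof.
rewrite -card_connected_pf_le //; apply: eq_card => pi.
by rewrite !inE cyclic_count_le.
Qed.

(** The strict bound on [r] keeps the exceptional top count out of the numerator, so the factor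
    common to all counts cancels. *)
Lemma cdf_scaled_cyclic_count n (r : R) : 0 <= r -> r < Num.sqrt n.+1%:R ->
  cdf (scaled_cyclic_count R n : {RV (uniform_connected_pf R n) >-> R}) r =
  (birthday_sum R n.+2 (Num.truncn (r * Num.sqrt n.+1%:R)) / total_sum R n)%:E.
Proof.
move=> r0 rn; have w0 : 0 < Num.sqrt n.+1%:R :> R by rewrite sqrtr_gt0.
pose m := Num.truncn (r * Num.sqrt n.+1%:R).
have mn : (m < n.+1)%N.
  rewrite truncn_lt_nat ?mulr_ge0 ?(ltW w0) //.
  by rewrite -[ltRHS]sqr_sqrtr // expr2 ltr_pM2r.
transitivity (uniform_connected_pf R n [set pi | (cyclic_count (val pi) <= m)%N]).
  rewrite /cdf /distribution /pushforward; congr (uniform_connected_pf R n _).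
  apply/seteqP; split => pi /=; rewrite in_itv /= /scaled_cyclic_count ler_pdivrMr //;
    by rewrite /m truncn_ge_nat // mulr_ge0 // ltW.
rewrite (uniform_connected_pfE (fun pi => cyclic_count (val pi) <= m)%N).
rewrite card_connected_pf_le // card_connected_pf.
rewrite sum_connected_count // sum_connected_count_total; congr EFin.
have K0 : n.+2%:R ^+ n / n.+2%:R != 0 :> R.
  by rewrite mulf_neq0 ?invr_eq0 ?expf_neq0 ?pnatr_eq0.
by rewrite -mulf_div divff // mul1r.
Qed.

End UniformConnected.

Theorem theorem32 (R : realType) :
  cvg_in_distribution
    (fun n => scaled_cyclic_count R n : {RV (uniform_connected_pf R n) >-> R})
    (abs_value R : {RV (normal_prob (0 : R) 1) >-> R}).
Proof.
move=> r _; set cdfZ := cdf _ r.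
have -> : cdfZ = (folded_normal_cdf r)%:E by rewrite /folded_normal_cdf fineK ?fin_num_measure.
have [r0|r0] := ltP r 0.
  rewrite folded_normal_cdf_lt0 //.
  rewrite (_ : (fun n => _) = fun=> 0%E); first exact: cvg_cst.
  apply/funext => n; rewrite /cdf /distribution /pushforward.
  rewrite (_ : _ @^-1` _ = set0) ?measure0 // -subset0 => pi /=.
  rewrite in_itv /= => /le_lt_trans/(_ r0).
  by rewrite /scaled_cyclic_count ltNge divr_ge0 // sqrtr_ge0.
have c0 : 0 < 2 * normal_peak (1 : R) by rewrite mulr_gt0 // normal_peak_gt0 // oner_neq0.
have ratio := cvg_birthday_ratio c0 (@folded_normal_cdf0 R) (@folded_normal_cdf_le1 R)
  (fun a b a0 ab => proj2 (andP (folded_normal_cdf_bounds a0 ab)))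
  (fun a b a0 ab => proj1 (andP (folded_normal_cdf_bounds a0 ab)))
  (@cvg_folded_normal_cdf R) r0.
have {ratio} : (birthday_sum R n.+2 (Num.truncn (r * Num.sqrt n.+1%:R)) / total_sum R n)%:E
    @[n --> \oo] --> (folded_normal_cdf r)%:E.
  by apply: cvg_EFin; [exact: nearW|exact: ratio].
(* Using [r + 1] yields the strict inequality [r < sqrt n.+1] for large [n]. *)
apply: cvg_trans; apply: near_eq_cvg; apply: filterS (near_le_sqrt (r + 1)) => n rn.
apply/esym/cdf_scaled_cyclic_count => //.
by apply: lt_le_trans rn; rewrite ltrDl.
Qed.
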